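(* Let $X$ be a locally compact non-compact metrizable space. Then $|\mathcal{E}(X)|=2^{w(X)}$, where $w(X)$ is the weight of $X$.
   Context: For a non-compact metrizable space $X$, $\mathcal{E}(X)$ denotes the set of all one-point metrizable extensions of $X$, i.e. metrizable spaces $Y=X\cup\{p\}$ with $p\notin X$ containing $X$ as a dense subspace, where two such extensions are identified if there is a homeomorphism between them fixing $X$ pointwise. *)

(* Defs.v *)
From HB Require Import structures.
From mathcomp Require Import all_boot all_order all_algebra.
From mathcomp Require Import all_classical all_reals all_analysis.

Set Implicit Arguments.
Unset Strict Implicit.
Unset Printing Implicit Defensive.

Local Open Scope classical_set_scope.
Local Open Scope card_scope.

Definition homeomorphism (X Y : topologicalType) (f : X -> Y) : Prop :=
  continuous f /\
  exists g : Y -> X, [/\ cancel f g, cancel g f & continuous g].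

(* A homeomorphism onto the range: the open sets of [X] are the traces of the
   open sets of [Y]. *)
Definition topological_embedding (X Y : topologicalType) (f : X -> Y) : Prop :=
  injective f /\
  forall A : set X, open A <-> exists2 B : set Y, open B & A = f @^-1` B.

(* The topology of [X] is induced by some metric; the library's [metricType]
   carries a chosen metric, so [X] is compared with one by a homeomorphism. *)
Definition metrizable (R : realType) (X : topologicalType) : Prop :=
  exists (M : metricType R) (f : X -> M), homeomorphism f.

(* A space Y = X `|` {p} with p outside X, metrizable and containing X as a
   dense subspace; the inclusion of X is the map [ext_incl]. *)
Record one_point_extension (R : realType) (X : topologicalType) := {
  ext_space :> topologicalType;
  ext_incl : X -> ext_space;
  ext_point : ext_space;
  ext_embedding : topological_embedding ext_incl;
  ext_remainder : ~` range ext_incl = [set ext_point];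
  ext_dense : dense (range ext_incl);
  ext_metrizable : metrizable R ext_space
}.

Definition extension_equiv (R : realType) (X : topologicalType)
    (Y Z : one_point_extension R X) : Prop :=
  exists2 h : Y -> Z, homeomorphism h &
    forall x : X, h (ext_incl Y x) = ext_incl Z x.

(* E(X), as the type of equivalence classes of [extension_equiv]. It is not a
   [set]: the extensions live in a universe above those [set] can range over. *)
Definition one_point_extensions (R : realType) (X : topologicalType) :=
  {C : one_point_extension R X -> Prop | exists Y, C = extension_equiv Y}.

(* Equality of cardinals. On subsets this is what the library's [#=] unfolds to
   (lemma [card_bijP]), which does not apply to [one_point_extensions] for the
   same universe reason. *)
Definition equipotent (A B : Type) : Prop := exists f : A -> B, bijective f.

Lemma min_card_exists (T : Type) (F : set (set T)) : F !=set0 ->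
  exists2 A, F A & forall B, F B -> A #<= B.
Proof.
move=> [A0 FA0].
pose P (S : set (set T -> T)) := forall B, F B ->
  (forall f, S f -> B (f B)) /\
  (forall f g, S f -> S g -> f B = g B -> f = g).
have [|S [PS Smax]] := @Zorn_bigcup _ P.
  move=> C CP Ctot B FB; split.
    by move=> f [S CS Sf]; have [/(_ f Sf)] := CP S CS B FB.
  move=> f g [S CS Sf] [S' CS' Sg] fg.
  have [SS|SS] := Ctot _ _ CS CS'.
    by have [_] := CP _ CS' B FB; apply => //; exact: SS.
  by have [_] := CP _ CS B FB; apply => //; exact: SS.
have [A FA SA] : exists2 A, F A & A `<=` (fun f => f A) @` S.
  apply: contrapT => noA.
  have missed A : exists x, F A -> A x /\ ~ ((fun f => f A) @` S) x.
    have [FA|nFA] := pselect (F A).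
      have /existsNP[x /not_implyP[Ax Sx]] :
          ~ (A `<=` (fun f => f A) @` S).
        by move=> SA; apply: noA; exists A.
      by exists x.
    have [] := pselect (exists x : T, True).
      by move=> [x _]; exists x.
    move=> T0; exfalso; apply: noA; exists A0 => // x _.
    by case: T0; exists x.
  have [g gP] := choice missed.
  apply: (Smax (S `|` [set g])).
    split; first by move=> f Sf; left.
    move=> /(_ g) gS; have [_] := gP A0 FA0; apply.
    by exists g => //; apply: gS; right.
  move=> B FB; have [SB Sinj] := PS B FB; have [gB gnS] := gP B FB; split.
    by move=> f [Sf|->//]; exact: SB.
  move=> f h [Sf|->] [Sh|->] // fh; first exact: Sinj.
    by exfalso; apply: gnS; exists f.
  by exfalso; apply: gnS; exists h.
exists A => // B FB; have [SB Sinj] := PS B FB.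
apply: (card_le_trans (subset_card_le SA)).
apply: (card_le_trans (card_image_le _ _)).
have inj : {in S &, injective (fun f : set T -> T => f B)}.
  by move=> f g /set_mem Sf /set_mem Sg; exact: Sinj.
rewrite -(card_le_eql (inj_card_eq inj)).
by apply: subset_card_le => _ [f Sf <-]; exact: SB.
Qed.

Lemma basis_open (X : topologicalType) : basis (@open X).
Proof.
split=> // x A; rewrite nbhsE => -[B oB BA].
by exists B.
Qed.

Lemma min_basis_exists (X : topologicalType) :
  exists B : set (set X), basis B /\ forall B' : set (set X), basis B' -> B #<= B'.
Proof.
have [|B bB Bmin] := @min_card_exists _ (@basis X).
  by exists (@open X); exact: basis_open.
by exists B.
Qed.

(* A base of least cardinality: as a type, it has w(X) elements. *)
Definition weight_basis (X : topologicalType) : set (set X) :=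
  sval (cid (min_basis_exists X)).
Arguments weight_basis : clear implicits.

Lemma weight_basisP (X : topologicalType) :
  basis (weight_basis X) /\
  forall B : set (set X), basis B -> weight_basis X #<= B.
Proof. exact: svalP (cid (min_basis_exists X)). Qed.

(* Main.v *)
Require Import Defs.
From HB Require Import structures.
From mathcomp Require Import all_boot all_order all_algebra.
From mathcomp Require Import all_classical all_reals all_analysis.
From mathcomp Require Import lra.

(** An extension Y of X by one point p is determined by the trace on X of the
neighbourhood filter of p: away from p the topology of Y is that of X, since
{p} is closed. So E(X) is in bijection with the set of all such traces
([extensions_equipotent_traces]), and it is the traces that are counted. Write
w for the weight of X.

At most 2^w traces: Y is metrizable, so the trace has a countable base of open
sets of X, and an open set is the union of the members of a base of least
cardinality that it contains. Hence a trace is coded by a subset of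
w * omega, and w * omega = w because w is infinite ([infinite_setX_nat]).

At least 2^w traces: fix a metric d on X. Local compactness gives a positive
function r, 1-Lipschitz, such that every ball of centre x and radius less than
r x has compact closure. Let S be a maximal set whose distinct points x, y
satisfy r x <= 4 d x y. By maximality the balls of centre x in S and radius
r x / 2 cover X. Each of them is totally bounded, so X has a base of
cardinality |S| * omega; and S is infinite because X is not compact. As S is
also discrete, w = |S| ([weight_basis_eq_separated]).

Split S into sequences indexed by S and one extra sequence (possible, since
|S| * omega = |S|). For a subset E of S there is a positive continuous function f
on X that tends to 0 along the extra sequence and along the sequences with index
in E, and is 1 on the other points of S ([spike], [spike_site]). Any
positive continuous f with infimum 0 is the distance to the new point for some
metric on the union of X and a point ([adjoin_point]); the sets f < e then
generate the trace. The traces obtained from different E differ, as they can be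
told apart by their behaviour along the sequences. *)

Set Implicit Arguments.
Unset Strict Implicit.
Unset Printing Implicit Defensive.

Import Order.TTheory GRing.Theory Num.Theory.
Import numFieldNormedType.Exports.

Local Open Scope classical_set_scope.
Local Open Scope ring_scope.

(** * Metrics as plain distance functions *)

Lemma exists_invS_lt (R : realType) (e : R) : 0 < e ->
  exists n, n.+1%:R^-1 < e.
Proof.
move=> e0; have [n _ /(_ n (leqnn n))] := near_infty_natSinv_lt (PosNum e0).
by exists n.
Qed.

Record is_metric (R : realType) (T : Type) (d : T -> T -> R) : Prop := {
  dist_xx : forall x, d x x = 0;
  dist_eq0 : forall x y, d x y = 0 -> x = y;
  dist_sym : forall x y, d x y = d y x;
  dist_triangle : forall y x z, d x z <= d x y + d y z
}.

Section MetricOf.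
Variables (R : realType) (T : choiceType) (d : T -> T -> R).
Hypothesis d_metric : is_metric d.

(** The type depends on the proof that [d] is a metric, so that the instances
below are found by unification and do not clash with others on [T]. *)
Definition metric_of of is_metric d : Type := T.

HB.instance Definition _ := Choice.on (metric_of d_metric).
HB.instance Definition _ := @isMetric.Build R (metric_of d_metric) d
  (dist_xx d_metric) (dist_eq0 d_metric) (dist_sym d_metric)
  (dist_triangle d_metric).

End MetricOf.

(** Metrizability in terms of a distance on [X] itself, which spares a transfer
along homeomorphisms: see [metrizableP]. *)
Definition induces (R : realType) (X : topologicalType) (d : X -> X -> R) :=
  is_metric d /\
  forall x A, nbhs x A <-> exists2 e, 0 < e & forall y, d x y < e -> A y.

Section MetricFacts.
Variables (R : realType) (T : Type) (d : T -> T -> R).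
Hypothesis d_metric : is_metric d.

Lemma dist_ge0 x y : 0 <= d x y.
Proof.
have := dist_triangle d_metric y x x.
rewrite (dist_sym d_metric y x) (dist_xx d_metric); lra.
Qed.

Lemma dist_gt0 x y : x <> y -> 0 < d x y.
Proof.
move=> xy; rewrite lt_neqAle dist_ge0 andbT eq_sym.
by apply/eqP => /(dist_eq0 d_metric).
Qed.

End MetricFacts.

Lemma metric_of_induces (R : realType) (T : choiceType) (d : T -> T -> R)
    (d_metric : is_metric d) : @induces R (metric_of d_metric) d.
Proof.
split=> // x A; rewrite -(@nbhs_ballE R); split.
  by move=> [e /= e0 eA]; exists e => // y dxy; apply: eA; rewrite ballEmdist.
by move=> [e e0 eA]; exists e => //= y; rewrite ballEmdist => /eA.
Qed.

Lemma metrizableP (R : realType) (X : topologicalType) :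
  metrizable R X <-> exists d : X -> X -> R, induces d.
Proof.
split.
  move=> [M [f [fc [g [fK gK gc]]]]]; exists (fun x y => mdist (f x) (f y)).
  split; first split.
  - by move=> x; exact: mdistxx.
  - by move=> x y /mdist_positivity/(can_inj fK).
  - by move=> x y; exact: metric_sym.
  - by move=> y x z; exact: metric_triangle.
  move=> x A; split.
    move=> xA; have /gc : nbhs (g (f x)) A by rewrite fK.
    rewrite nbhs_filterE /= -(@nbhs_ballE R) => -[e /= e0 eA].
    exists e => // y xy; rewrite -[y]fK; apply: eA.
    by rewrite ballEmdist.
  move=> [e e0 eA]; have : nbhs x (f @^-1` ball (f x) e).
    by apply: fc; exact: nbhsx_ballx.
  by apply: filterS => y; rewrite /= ballEmdist => /eA.
move=> [d [dm dX]]; exists (metric_of dm), id.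
have same (x : X) (A : set X) : nbhs (x : metric_of dm) A <-> nbhs x A.
  have [_ dY] := metric_of_induces dm.
  by split=> [/(dY x) xA|/(dX x) xA]; [apply/(dX x)|apply/(dY x)].
by split=> [x A /same|]; [|exists id; split=> // x A /same].
Qed.

Lemma nbhs_embedding (X Y : topologicalType) (f : X -> Y) : injective f ->
  (forall x B, nbhs (f x) B <-> nbhs x (f @^-1` B)) -> topological_embedding f.
Proof.
move=> finj fnbhs; split=> // A; split.
  rewrite openE => oA; exists (f @` A).
    rewrite openE => _ [x Ax <-]; rewrite /interior.
    by apply/(fnbhs x); apply: filterS (oA x Ax) => y Ay; exists y.
  by apply/seteqP; split=> [x Ax|x [y Ay /finj <-//]]; exists x.
move=> [B + ->]; rewrite !openE => oB x /oB; rewrite /interior.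
by move=> /fnbhs.
Qed.

(** * The trace of an extension *)

Section Extension.
Variables (R : realType) (X : topologicalType).
Implicit Type Y Z : one_point_extension R X.

Lemma ext_incl_inj Y : injective (ext_incl Y).
Proof. by have [] := ext_embedding Y. Qed.

Lemma ext_incl_neq Y x : ext_incl Y x <> ext_point Y.
Proof.
move=> xp; have : [set ext_point Y] (ext_point Y) by [].
by rewrite -ext_remainder; apply; exists x.
Qed.

Lemma ext_cases Y (y : Y) : y = ext_point Y \/ exists x, y = ext_incl Y x.
Proof.
have [[x _ <-]|] := pselect (range (ext_incl Y) y); first by right; exists x.
move=> ny; left; have : (~` range (ext_incl Y)) y by [].
by rewrite ext_remainder.
Qed.

(** [X] is open in the extension, because a metrizable space is T1. *)
Lemma nbhs_ext_incl Y x (B : set Y) :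
  nbhs (ext_incl Y x) B <-> nbhs x (ext_incl Y @^-1` B).
Proof.
have [_ emb] := ext_embedding Y.
have [d [dm dY]] := (metrizableP R Y).1 (ext_metrizable Y).
split.
  rewrite nbhsE => -[U [oU Ux] UB]; rewrite nbhsE.
  exists (ext_incl Y @^-1` U); last by move=> y; exact: UB.
  by split=> //; apply/emb; exists U.
rewrite nbhsE => -[U [oU Ux] UB]; have [V oV UV] := (emb U).1 oU.
have Vx : V (ext_incl Y x) by move: Ux; rewrite UV.
have : nbhs (ext_incl Y x) (V `&` [set~ ext_point Y]).
  apply: filterI; first exact: open_nbhs_nbhs.
  apply/(dY (ext_incl Y x)); exists (d (ext_incl Y x) (ext_point Y)).
    by apply: dist_gt0 => //; exact: ext_incl_neq.
  by move=> y /[swap] ->; rewrite ltxx.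
apply: filterS => y [Vy yp]; have [//|[z yz]] := ext_cases y.
by rewrite yz; apply: UB; rewrite UV /= -yz.
Qed.

(** The neighbourhood filter of the new point, restricted to [X]. *)
Definition trace Y : set (set X) :=
  [set A | nbhs (ext_point Y) [set y | forall x, ext_incl Y x = y -> A x]].

Lemma nbhs_ext_point Y (B : set Y) : nbhs (ext_point Y) B <->
  B (ext_point Y) /\ trace Y (ext_incl Y @^-1` B).
Proof.
split=> [pB|[Bp]].
  split; first exact: nbhs_singleton pB.
  by apply: filterS pB => y By x xy; rewrite /= xy.
rewrite /trace /=; apply: filterS => y; have [->//|[x ->]] := ext_cases y.
exact.
Qed.

Lemma ext_map Y Z : exists h : Y -> Z,
  h (ext_point Y) = ext_point Z /\ forall x, h (ext_incl Y x) = ext_incl Z x.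
Proof.
have /choice[h hP] (y : Y) : exists z : Z,
    (y = ext_point Y /\ z = ext_point Z) \/
    exists2 x, y = ext_incl Y x & z = ext_incl Z x.
  have [->|[x ->]] := ext_cases y; first by exists (ext_point Z); left.
  by exists (ext_incl Z x); right; exists x.
exists h; split.
  by have [[]//|[x /esym /ext_incl_neq[]]] := hP (ext_point Y).
move=> x; have [[/ext_incl_neq[]]|[z + ->]] := hP (ext_incl Y x).
by move=> /ext_incl_inj ->.
Qed.

(** Continuity holds at the points of [X] whatever the traces are, by
[nbhs_ext_incl]; so only the new point imposes a condition. *)
Lemma ext_map_continuous Y Z (h : Y -> Z) : h (ext_point Y) = ext_point Z ->
  (forall x, h (ext_incl Y x) = ext_incl Z x) ->
  (continuous h <-> trace Z `<=` trace Y).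
Proof.
move=> hp hx.
have preim B : ext_incl Y @^-1` (h @^-1` B) = ext_incl Z @^-1` B.
  by apply/seteqP; split=> x; rewrite /= hx.
split=> [hc A ZA|ZY y A].
  pose B := [set z | forall x, ext_incl Z x = z -> A x].
  have /nbhs_ext_point[_] : nbhs (ext_point Y) (h @^-1` B).
    by apply: hc; rewrite hp.
  by rewrite preim /trace /=; apply: filterS => y yB x /yB /(_ x); exact.
have [->|[x ->]] := ext_cases y; rewrite ?hp ?hx.
  move=> /nbhs_ext_point[Ap tA]; apply/nbhs_ext_point.
  by rewrite preim /= hp; split=> //; exact: ZY.
by move=> /nbhs_ext_incl; rewrite -preim => /nbhs_ext_incl.
Qed.

Lemma extension_equivP Y Z : extension_equiv Y Z <-> trace Y = trace Z.
Proof.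
split=> [[h [hc [g [hK gK gc]]] hx]|YZ].
  have gx x : g (ext_incl Z x) = ext_incl Y x by rewrite -hx hK.
  have hp : h (ext_point Y) = ext_point Z.
    have [//|[x hpx]] := ext_cases (h (ext_point Y)).
    by have := congr1 g hpx; rewrite gx hK => /esym/ext_incl_neq.
  have gp : g (ext_point Z) = ext_point Y by rewrite -hp hK.
  by apply/seteqP; split; [apply/(ext_map_continuous gp gx)|
                           apply/(ext_map_continuous hp hx)].
have [h [hp hx]] := ext_map Y Z; have [g [gp gx]] := ext_map Z Y.
exists h => //; split; first by apply/(ext_map_continuous hp hx); rewrite YZ.
exists g; split; last by apply/(ext_map_continuous gp gx); rewrite YZ.
  by move=> y; have [->|[x ->]] := ext_cases y; rewrite ?hp ?gp ?hx ?gx.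
by move=> y; have [->|[x ->]] := ext_cases y; rewrite ?gp ?hp ?gx ?hx.
Qed.

(** Unlike E(X), this lives in the universe of [set (set (set X))], where the
cardinality relations apply. *)
Definition traces : set (set (set X)) :=
  fun F => exists Y : one_point_extension R X, F = trace Y.

Lemma extension_class (C : one_point_extensions R X) :
  exists Y, forall Z, sval C Z <-> trace Y = trace Z.
Proof.
have [Y CY] := svalP C; exists Y => Z; rewrite CY; exact: extension_equivP.
Qed.

Lemma extensions_equipotent_traces :
  equipotent (one_point_extensions R X) traces.
Proof.
(* The common trace of the members of a class, obtained without choosing one. *)
pose tr (C : one_point_extensions R X) A := exists2 Y, sval C Y & trace Y A.
have trE C Y : sval C Y -> tr C = trace Y.
  have [Z CZ] := extension_class C => /CZ YZ.
  apply/seteqP; split=> A /=; rewrite -YZ.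
    by move=> [W /CZ ->].
  by move=> ZA; exists Z => //; apply/CZ.
have trP C : traces (tr C).
  by have [Y CY] := extension_class C; exists Y; apply: trE; apply/CY.
have ex (F : traces) : exists C : one_point_extensions R X, tr C = sval F.
  case: F => F FP; have [Y FY] := set_mem FP.
  exists (exist _ (extension_equiv Y) (ex_intro _ Y erefl)) => /=.
  by rewrite FY; apply: trE; exact/extension_equivP.
have [g gP] := choice ex.
have eq_sval (C C' : one_point_extensions R X) : sval C = sval C' -> C = C'.
  by case: C C' => C p [C' p'] /= CC'; apply: eq_exist.
have tr_inj C C' : tr C = tr C' -> C = C'.
  have [Y CY] := extension_class C; have [Y' CY'] := extension_class C'.
  rewrite (trE C Y) ?(trE C' Y'); [|exact/CY'|exact/CY].
  move=> YY'; apply: eq_sval; apply: funext => Z; apply: propext.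
  by apply: (iff_trans (CY Z)); rewrite YY'; apply: iff_sym.
exists (fun C => SigSub (mem_set (trP C))), g => [C|F].
  by apply: tr_inj; rewrite gP.
by apply: val_inj; rewrite /= gP.
Qed.

End Extension.

(** * The extension defined by a positive function of infimum zero *)

Section AdjoinPoint.
Variables (R : realType) (X : topologicalType) (d : X -> X -> R) (f : X -> R).
Hypothesis dX : induces d.
Hypothesis f_gt0 : forall x, 0 < f x.
Hypothesis f_cont : forall x (e : R), 0 < e ->
  exists2 c : R, 0 < c & forall y, d x y < c -> `|f x - f y| < e.
Hypothesis f_small : forall e : R, 0 < e -> exists x, f x < e.

Let dm : is_metric d := dX.1.

(** The metric of a cone over [X]: the shorter of the path in [X], whose length
is corrected so that [f] is 1-Lipschitz, and the path through the new point. *)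
Definition adjoin_dist (u v : option X) : R :=
  match u, v with
  | Some x, Some y => Num.min (d x y + `|f x - f y|) (f x + f y)
  | Some x, None | None, Some x => f x
  | None, None => 0
  end.

Lemma adjoin_dist_metric : is_metric adjoin_dist.
Proof.
split.
- case=> [x|] //=; rewrite (dist_xx dm) subrr normr0 addr0 minElt.
  by have := f_gt0 x; case: ifP => // /negbT; rewrite -leNgt; lra.
- have f_neq0 x : f x = 0 -> False by move=> fx; have := f_gt0 x; rewrite fx ltxx.
  case=> [x|] [y|] //=; try by move=> /f_neq0.
  move=> xy; congr Some; apply: contrapT => /(dist_gt0 dm) d0; move: xy.
  have := f_gt0 x; have := f_gt0 y; have := normr_ge0 (f x - f y).
  by rewrite minElt; case: ifP => _; lra.
- by case=> [x|] [y|] //=; rewrite (dist_sym dm) distrC [f x + _]addrC.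
case=> [y|] [x|] [z|]; rewrite /= ?addr0 ?add0r //.
- have := dist_triangle dm y x z; have := ler_distD (f y) (f x) (f z).
  have := ler_norm (f x - f y); have := ler_norm (f z - f y).
  rewrite [`|f z - f y|]distrC.
  have := f_gt0 x; have := f_gt0 y; have := f_gt0 z.
  have := dist_ge0 dm x y; have := dist_ge0 dm y z.
  by rewrite !minElt; case: ifP => ?; case: ifP => ?; case: ifP => ?; lra.
- have := f_gt0 y; have := f_gt0 x; have := ler_norm (f x - f y).
  have := dist_ge0 dm x y.
  by rewrite minElt; case: ifP; lra.
- have := f_gt0 y; have := f_gt0 z; have := ler_norm (f z - f y).
  rewrite distrC; have := dist_ge0 dm y z.
  by rewrite minElt; case: ifP; lra.
- by have := f_gt0 y; lra.
- by rewrite minElt; case: ifP; lra.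
Qed.

Let Y : topologicalType := metric_of adjoin_dist_metric.

Let nbhsY (u : Y) (A : set Y) :
  nbhs u A <-> exists2 e, 0 < e & forall v, adjoin_dist u v < e -> A v.
Proof. exact: (metric_of_induces adjoin_dist_metric).2. Qed.

(** Within distance [f x] of [x] the path through the new point is too long to
matter, so that the topology of [X] is unchanged. *)
Lemma nbhs_adjoin_some x (A : set Y) :
  nbhs (Some x : Y) A <-> nbhs x ((Some : X -> Y) @^-1` A).
Proof.
split.
  move=> /nbhsY[e e0 eA]; apply/(dX.2 x).
  have [|c c0 cf] := @f_cont x (e / 2); first by lra.
  exists (Num.min c (e / 2)); first by rewrite lt_min c0; lra.
  move=> y; rewrite lt_min => /andP[/cf xyc xye]; apply: eA.
  by rewrite /= gt_min; apply/orP; left; lra.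
move=> /(dX.2 x)[e e0 eA]; apply/nbhsY; exists (Num.min e (f x)).
  by rewrite lt_min e0 f_gt0.
case=> [y|]; rewrite /adjoin_dist lt_min; last by rewrite ltxx andbF.
rewrite !gt_min => xy; apply: eA; move: xy.
have := f_gt0 y; have := normr_ge0 (f x - f y).
by move=> ? ? /andP[/orP[?|?] /orP[?|?]]; lra.
Qed.

Lemma some_injective : injective (Some : X -> Y).
Proof. by move=> x y []. Qed.

Lemma range_some : ~` range (Some : X -> Y) = [set None : Y].
Proof.
apply/seteqP; split=> [[x|] //= nx|_ -> [x _]//].
by case: nx; exists x.
Qed.

Lemma dense_some : dense (range (Some : X -> Y)).
Proof.
move=> A [[x|] Au] oA; first by exists (Some x); split=> //; exists x.
have /nbhsY[e e0 eA] : nbhs (None : Y) A by exact: open_nbhs_nbhs.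
have [x fx] := f_small e0.
by exists (Some x); split; [exact: eA|exists x].
Qed.

Lemma adjoin_metrizable : metrizable R Y.
Proof.
by apply/metrizableP; exists adjoin_dist; exact: metric_of_induces.
Qed.

Definition adjoin_point : one_point_extension R X :=
  Build_one_point_extension
    (nbhs_embedding some_injective nbhs_adjoin_some)
    range_some dense_some adjoin_metrizable.

Lemma trace_adjoin_point A : trace adjoin_point A <->
  exists2 e, 0 < e & forall x, f x < e -> A x.
Proof.
split.
  by move=> /nbhsY[e e0 eA]; exists e => // x fx; exact: (eA (Some x)).
move=> [e e0 eA]; apply/nbhsY; exists e => // -[y|] //= fy x [->].
exact: eA.
Qed.

End AdjoinPoint.

(** * Cardinal arithmetic *)

Section Cardinals.
Local Open Scope card_scope.

Lemma card_le_injP (T U : Type) (A : set T) (B : set U) :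
  A #<= B <-> exists f : A -> B, injective f.
Proof.
split=> [/card_leP[f]|[f finj]].
  by exists f => x y; apply: (@inj _ _ _ f); rewrite inE.
apply/card_leP/injfunPex; exists f => //.
by move=> x y _ _; exact: finj.
Qed.

Lemma card_leT_injP (T U : Type) :
  [set: T] #<= [set: U] <-> exists f : T -> U, injective f.
Proof.
split=> [/card_le_injP[f finj]|[f finj]].
  exists (fun x => sval (f (SigSub (mem_set (I : [set: T] x))))) => x y.
  by move=> /val_inj/finj[].
apply/card_le_injP.
exists (fun x => SigSub (mem_set (I : [set: U] (f (sval x))))) => x y.
by move=> [/finj] /val_inj.
Qed.

Lemma card_le_powerset (T U : Type) :
  [set: T] #<= [set: U] -> [set: set T] #<= [set: set U].
Proof.
move=> /card_leT_injP[f finj]; apply/card_leT_injP.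
exists (fun A => f @` A) => A B AB.
have sub C D : f @` C = f @` D -> C `<=` D.
  move=> CD x Cx; have : (f @` D) (f x) by rewrite -CD; exists x.
  by move=> [y Dy /finj <-].
by apply/seteqP; split; exact: sub.
Qed.

(** By Zorn's lemma take a maximal family of injective sequences with pairwise
disjoint ranges. They miss only finitely many points, since otherwise one more
sequence could be added; let [e] enumerate the missed points. A point is then
coded by a sequence of the family, an index and a bit telling whether the index
refers to that sequence or to [e]. The bit, the index and one more natural number
are packed into a new index in the same sequence. *)
Lemma infinite_setX_nat (T : Type) : infinite_set [set: T] ->
  exists j : T * nat -> T, injective j.
Proof.
move=> Tinf.
pose P (S : set (nat -> T)) := forall f g m n, S f -> S g -> f m = g n ->
  f = g /\ m = n.
have [|S [PS Smax]] := @Zorn_bigcup _ P.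
  move=> F FP Ftot f g m n [S FS Sf] [S' FS' Sg].
  have [SS|SS] := Ftot _ _ FS FS'; first by apply: (FP _ FS') => //; exact: SS.
  by apply: (FP _ FS) => //; exact: SS.
pose U := [set t | exists2 f, S f & exists n, t = f n].
have cofinU : finite_set (~` U).
  apply: contrapT => /infiniteP /card_le_injP[g0 g0inj].
  pose g (n : nat) := sval (g0 (SigSub (mem_set (I : [set: nat] n)))).
  have ginj m n : g m = g n -> m = n by move=> /val_inj/g0inj[].
  have gU n : ~ U (g n).
    by have := set_mem (svalP (g0 (SigSub (mem_set (I : [set: nat] n))))).
  apply: (Smax (S `|` [set g])).
    split; first by move=> f Sf; left.
    by move=> /(_ g) gS; apply: (gU 0%N); exists g; [apply: gS; right|exists 0%N].
  move=> f h m n [Sf|->] [Sh|->].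
  - exact: PS.
  - by move=> fg; exfalso; apply: (gU n); exists f => //; exists m.
  - by move=> gh; exfalso; apply: (gU m); exists h => //; exists n.
  - by move=> /ginj.
have [e eU] : exists e : nat -> T, ~` U `<=` range e.
  have [t0 _] := infinite_setN0 Tinf.
  have /pfcard_geP[->|] := finite_set_countable cofinU.
    by exists (fun=> t0).
  by move=> [e]; exists e => t /(@surj _ _ _ _ e)[n _ <-]; exists n.
have [f0 Sf0] : S !=set0.
  apply: contrapT => S0; apply: Tinf; apply: sub_finite_set cofinU => t _.
  by move=> [f Sf]; apply: False_ind; apply: S0; exists f.
have /choice[c cP] (t : T) : exists c : (nat -> T) * (bool * nat),
    S c.1 /\ t = (if c.2.1 then e c.2.2 else c.1 c.2.2).
  have [[f Sf [n ->]]|/eU[n _ <-]] := pselect (U t).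
    by exists (f, (false, n)).
  by exists (f0, (true, n)).
exists (fun tm => (c tm.1).1 (choice.pickle ((c tm.1).2, tm.2))) => -[t m] [s n] /=.
have [St tE] := cP t; have [Ss sE] := cP s.
move=> /(PS _ _ _ _ St Ss)[fE /(pcan_inj choice.pickleK)[cE ->]].
by rewrite tE sE fE cE.
Qed.

End Cardinals.

(** * The weight of a locally compact metrizable space *)

Section CompactRadius.
Variables (R : realType) (X : topologicalType) (d : X -> X -> R).
Hypothesis dX : induces d.
Hypothesis X_locally_compact : locally_compact [set: X].

Let dm : is_metric d := dX.1.

Let dball x e := [set y | d x y < e].

Lemma dball_nbhs x e : 0 < e -> nbhs x (dball x e).
Proof. by move=> e0; apply/(dX.2 x); exists e. Qed.

Lemma dball_open x e : open (dball x e).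
Proof.
rewrite openE => y xy; apply/(dX.2 y); exists (e - d x y).
  by rewrite subr_gt0.
by move=> z yz; rewrite /dball /=; have := dist_triangle dm y x z; lra.
Qed.

Let radii x := [set e | e <= 1 /\ precompact (dball x e)].

(** Radii are cut at 1 to keep the supremum finite when all balls are
relatively compact. *)
Definition compact_radius x := sup (radii x).
Local Notation r := compact_radius.

Lemma radii0 x : radii x 0.
Proof.
split=> //; rewrite precompactE.
suff -> : dball x 0 = set0 by rewrite closure0; exact: compact0.
by apply/seteqP; split=> // y; rewrite /dball /= ltNge (dist_ge0 dm).
Qed.

Lemma radii_ub x : ubound (radii x) 1.
Proof. by move=> e []. Qed.

Lemma radii_le x e : radii x e -> e <= r x.
Proof. by move=> xe; apply: ub_le_sup xe; exists 1; exact: radii_ub. Qed.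

Lemma compact_radius_gt0 x : 0 < r x.
Proof.
have := X_locally_compact (I : [set: X] x).
rewrite withinET => -[U /(dX.2 x)[e e0 eU] Ucpt].
apply: lt_le_trans (radii_le (e := Num.min 1 e) _); first by rewrite lt_min ltr01.
split; first by rewrite ge_min lexx.
by exists U => // y; rewrite /dball /= lt_min => /andP[_ /eU].
Qed.

(** The ball of centre [y] and radius [e - d x y] lies in the one of centre [x]
and radius [e]. *)
Lemma compact_radius_lipschitz x y : r x <= r y + d x y.
Proof.
apply: ge_sup; first by exists 0; exact: radii0.
move=> e [e1 xe]; rewrite -lerBlDr; apply: radii_le; split.
  by have := dist_ge0 dm x y; lra.
apply: precompact_subset xe => z; rewrite /dball /=.
by have := dist_triangle dm y x z; lra.
Qed.

Lemma precompact_dball x e : e < r x -> precompact (dball x e).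
Proof.
move=> er; have [||c [_ xc] ec] := @sup_gt _ (radii x) e.
- by exists 0; exact: radii0.
- exact: er.
by apply: precompact_subset xc => y; rewrite /dball /=; lra.
Qed.

(** The sequence enumerates a finite net, and is then constantly [x0]. *)
Lemma precompact_totally_bounded (x0 : X) (A : set X) (e : R) : 0 < e ->
  precompact A -> exists c : nat -> X, forall y, A y -> exists k, d (c k) y < e.
Proof.
move=> e0; rewrite precompactE.
(* [compact_cover] is about pointed spaces: [x0] serves as base point. *)
pose PX : ptopologicalType := HB.pack (Topological.sort X) (isPointed.Build X x0).
rewrite -[compact _]/(compact (closure A : set PX)) compact_cover.
move=> /(_ X [set: X] (dball^~ e))[|y _|F _ AF].
- by move=> x _; exact: dball_open.
- by exists y => //; rewrite /dball /= (dist_xx dm).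
exists (nth x0 (finmap.enum_fset F)) => y /subset_closure/AF[x xF xy].
by exists (index x (finmap.enum_fset F)); rewrite nth_index.
Qed.

(** With [compact_radius] being 1-Lipschitz, this makes the set closed and
discrete, at a scale that varies with the point. *)
Definition radius_separated (S : set X) :=
  forall x y, S x -> S y -> x <> y -> r x <= 4 * d x y.

(** If [y] is at distance at least [r x / 2] of every [x] in the maximal set,
then [y] may be added to it: as [r] is 1-Lipschitz, [r y] is at most
[r x + d x y <= 3 * d x y]. *)
Lemma maximal_separated : exists2 S, radius_separated S &
  forall y, exists2 x, S x & d x y < r x / 2.
Proof.
have [|S [sepS Smax]] := @Zorn_bigcup _ radius_separated.
  move=> F Fsep Ftot x y [S FS Sx] [S' FS' Sy].
  have [SS|SS] := Ftot _ _ FS FS'; first by apply: (Fsep _ FS') => //; exact: SS.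
  by apply: (Fsep _ FS) => //; exact: SS.
exists S => // y; apply: contrapT => far.
have farx x : S x -> r x / 2 <= d x y.
  by move=> Sx; rewrite leNgt; apply/negP => xy; apply: far; exists x.
have nSy : ~ S y.
  move=> /farx; rewrite (dist_xx dm); have := compact_radius_gt0 y; lra.
apply: (Smax (S `|` [set y])).
  split; first by move=> x Sx; left.
  by move=> /(_ y) yS; apply: nSy; apply: yS; right.
move=> x z [Sx|->] [Sz|->] xz.
- exact: sepS.
- have := farx x Sx; have := compact_radius_gt0 x; lra.
- have := farx z Sz; have := compact_radius_lipschitz y z.
  rewrite (dist_sym dm z y); have := dist_ge0 dm y z.
  by have := compact_radius_gt0 z; lra.
- by [].
Qed.

Hypothesis X_noncompact : ~ compact [set: X].
Variable S : set X.
Hypothesis S_sep : radius_separated S.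
Hypothesis S_cov : forall y, exists2 x, S x & d x y < r x / 2.

Lemma precompact_half x : precompact (dball x (r x / 2)).
Proof. by apply: precompact_dball; have := compact_radius_gt0 x; lra. Qed.

(** A finite [S] would cover [X] by finitely many relatively compact balls. *)
Lemma separated_infinite : infinite_set S.
Proof.
move=> /finite_seqP[s SF]; apply: X_noncompact.
have <- : \bigcup_(x in [set` s]) closure (dball x (r x / 2)) = [set: X].
  apply/seteqP; split=> // y _; have [x Sx xy] := S_cov y.
  by exists x; [rewrite -SF|exact: subset_closure].
rewrite bigcup_seq; apply: bigsetU_compact => x _.
by rewrite -precompactE; exact: precompact_half.
Qed.

(** A ball of radius [r x / 4] around a point [x] of [S] contains no other point
of [S], so that members of [B] lying between [x] and its ball are distinct for
distinct [x]. *)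
Lemma separated_le_basis (B : set (set X)) : basis B -> (S #<= B)%card.
Proof.
move=> [_ Bx].
have /choice[U UP] (x : S) : exists U : B, sval U (sval x) /\
    sval U `<=` dball (sval x) (r (sval x) / 4).
  have [|U [BU Ux] Usub] := Bx (sval x) (dball (sval x) (r (sval x) / 4)).
    by apply: dball_nbhs; have := compact_radius_gt0 (sval x); lra.
  by exists (SigSub (mem_set BU)).
apply/card_le_injP; exists U => x y Uxy; apply: val_inj; apply: contrapT => xy.
have := S_sep (set_mem (svalP x)) (set_mem (svalP y)) xy.
have [_ /(_ (sval y))] := UP x; rewrite Uxy => /(_ (UP y).1).
by rewrite /dball /=; lra.
Qed.

(** The balls of radius [1 / n] around the points of a countable net in each
piece of the cover, where the net depends on [n]. *)
Lemma basis_le_separated : exists2 B : set (set X), basis B & (B #<= S)%card.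
Proof.
have [x0 _] := infinite_setN0 separated_infinite.
have /choice[c cP] (xn : X * nat) : exists c : nat -> X,
    forall y, dball xn.1 (r xn.1 / 2) y -> exists k, d (c k) y < xn.2.+1%:R^-1.
  apply: (precompact_totally_bounded x0); last exact: precompact_half.
  by rewrite invr_gt0 ltr0n.
pose b (x : S * nat * nat) :=
  dball (c (sval x.1.1, x.1.2) x.2) x.1.2.+1%:R^-1.
exists (range b).
  split; first by move=> _ [x _ <-]; exact: dball_open.
  move=> y A /(dX.2 y)[e e0 eA].
  have [n nP] : exists n, n.+1%:R^-1 < e / 2 :> R.
    by apply: exists_invS_lt; rewrite divr_gt0.
  have [x Sx xy] := S_cov y.
  have [k kP] := cP (x, n) y xy.
  exists (b (SigSub (mem_set Sx), n, k)).
    by split=> //; exists (SigSub (mem_set Sx), n, k).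
  move=> z; rewrite /b /dball /= => cz; apply: eA.
  have := dist_triangle dm (c (x, n) k) y z; rewrite (dist_sym dm y (c _ _)).
  move: kP nP cz => /=; move: n.+1%:R^-1 => q; lra.
apply: card_le_trans (card_image_le _ _) _.
have [|j jinj] := @infinite_setX_nat S.
  by rewrite (eq_finite_set (card_setT S)); exact: separated_infinite.
apply: (@card_le_trans _ _ _ [set: S]); last by rewrite (card_le_eql (card_setT S)).
apply/card_leT_injP; exists (fun x => j (j x.1, x.2)) => -[x m] [y n] /=.
by move=> /jinj[/jinj -> ->].
Qed.

Lemma weight_basis_eq_separated : (weight_basis X #= S)%card.
Proof.
have [wb wmin] := weight_basisP X; apply/card_eqPle; split.
  have [B bB BS] := basis_le_separated.
  exact: card_le_trans (wmin B bB) BS.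
exact: separated_le_basis.
Qed.

End CompactRadius.

(** * A continuous function with prescribed values on a separated set *)

Lemma induces_continuous (R : realType) (X : topologicalType)
    (d : X -> X -> R) (f : X -> R) : induces d ->
  continuous f <-> forall x (e : R), 0 < e ->
    exists2 c : R, 0 < c & forall y, d x y < c -> `|f x - f y| < e.
Proof.
move=> dX; split=> [fc x e e0|fc x].
  by have /cvgrPdist_lt/(_ e e0)/(dX.2 x) := fc x.
apply/cvgrPdist_lt => e /(fc x) xe; exact/(dX.2 x).
Qed.

Lemma lipschitz_continuous (R : realType) (X : topologicalType)
    (d : X -> X -> R) (f : X -> R) (k : R) : induces d -> 0 < k ->
  (forall x y, f x <= f y + k * d x y) -> continuous f.
Proof.
move=> dX k0 fk; apply/(induces_continuous _ dX) => x e e0.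
exists (e / k); first by rewrite divr_gt0.
move=> y; rewrite ltr_pdivlMr // mulrC => xy; rewrite ltr_norml.
have := fk x y; have := fk y x; rewrite (dist_sym dX.1 y x).
by move=> *; apply/andP; split; lra.
Qed.

Section SpikeFunction.
Variables (R : realType) (X : topologicalType) (d : X -> X -> R).
Variables (r : X -> R) (S : set X) (v : X -> R).
Hypothesis dX : induces d.
Hypothesis r_gt0 : forall x, 0 < r x.
Hypothesis r_lip : forall x y, r x <= r y + d x y.
Hypothesis S_sep : forall x y, S x -> S y -> x <> y -> r x <= 4 * d x y.
Hypothesis v_gt0 : forall x, 0 < v x.
Hypothesis v_le1 : forall x, v x <= 1.
Hypothesis v_small : forall e : R, 0 < e -> exists2 s, S s & v s < e.

Let dm : is_metric d := dX.1.

(** The function is the infimum over [s] in [S] of [v s + 4 * d x s / r x];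
with the common denominator [r x] taken out, the infimum is one of uniformly
Lipschitz functions of [x], hence it is continuous. *)
Definition spike_numerator x := inf [set v s * r x + 4 * d x s | s in S].
Local Notation H := spike_numerator.

Lemma spike_numerator_le x s : S s -> H x <= v s * r x + 4 * d x s.
Proof.
move=> Ss; apply: ge_inf; last by exists s.
exists 0 => _ [t _ <-]; have := dist_ge0 dm x t.
by have := mulr_gt0 (v_gt0 t) (r_gt0 x); lra.
Qed.

Lemma le_spike_numerator x c :
  (forall s, S s -> c <= v s * r x + 4 * d x s) -> c <= H x.
Proof.
move=> cS; apply: lb_le_inf; last by move=> _ [s Ss <-]; exact: cS.
have [s Ss _] := v_small ltr01.
by exists (v s * r x + 4 * d x s), s.
Qed.

Lemma spike_numerator_lipschitz x y : H x <= H y + 5 * d x y.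
Proof.
rewrite -lerBlDr; apply: le_spike_numerator => s Ss.
have := spike_numerator_le x Ss; have := dist_triangle dm y x s.
have : v s * r x <= v s * r y + d x y.
  apply: le_trans (_ : v s * (r y + d x y) <= _).
    by rewrite ler_pM2l.
  by rewrite mulrDr lerD2l ler_piMl // (dist_ge0 dm).
by lra.
Qed.

(** At most one point of [S] is close to [x] in comparison with [r x], so that
the infimum is not approached along a sequence in [S] with [v] tending to 0.
The factor 16 is large enough for two such points to contradict the separation
of [S]. *)
Lemma spike_numerator_gt0 x : 0 < H x.
Proof.
have rx := r_gt0 x.
have [[s Ss xs]|far] := pselect (exists2 s, S s & 16 * d x s < r x).
  have vr := mulr_gt0 (v_gt0 s) rx.
  apply: (@lt_le_trans _ _ (Num.min (v s * r x) (r x / 4))).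
    by rewrite lt_min vr; lra.
  apply: le_spike_numerator => t St; rewrite ge_min; apply/orP.
  have [->|st] := pselect (t = s); first by left; have := dist_ge0 dm x s; lra.
  right; have := S_sep Ss St (nesym st); have := dist_triangle dm x s t.
  rewrite (dist_sym dm s x); have := r_lip x s.
  by have := mulr_gt0 (v_gt0 t) rx; lra.
apply: (@lt_le_trans _ _ (r x / 4)); first by lra.
apply: le_spike_numerator => t St; have := mulr_gt0 (v_gt0 t) rx.
suff : r x <= 16 * d x t by lra.
by rewrite leNgt; apply/negP => xt; apply: far; exists t.
Qed.

Definition spike x := H x / r x.

Lemma spike_gt0 x : 0 < spike x.
Proof. by rewrite divr_gt0 ?spike_numerator_gt0. Qed.

Lemma spike_continuous : continuous spike.
Proof.
move=> x; apply: cvgM.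
  exact: (lipschitz_continuous dX _ spike_numerator_lipschitz).
apply: cvgV; first by rewrite gt_eqF.
apply: (lipschitz_continuous dX ltr01) => y z; rewrite mul1r; exact: r_lip.
Qed.

(** At a point [s] of [S] every other term is at least [4 * d s t / r s], which
is at least 1, hence at least [v s]. *)
Lemma spike_site s : S s -> spike s = v s.
Proof.
move=> Ss; apply/eqP; rewrite /spike eq_le.
rewrite ler_pdivrMr // ler_pdivlMr //; apply/andP; split.
  by have := spike_numerator_le s Ss; rewrite (dist_xx dm) mulr0 addr0.
apply: le_spike_numerator => t St; have [->|ts] := pselect (t = s).
  by rewrite (dist_xx dm) mulr0 addr0.
have := S_sep Ss St (nesym ts); have := mulr_gt0 (v_gt0 t) (r_gt0 s).
have : v s * r s <= r s by rewrite ler_piMl // ltW.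
by lra.
Qed.

(** On [S] the sets of the trace are those that contain the points where [v] is
small enough; this is all that is needed to tell such traces apart. *)
Lemma trace_with_values : exists F, [/\ traces R F,
  forall A, F A -> exists2 e : R, 0 < e & forall s, S s -> v s < e -> A s &
  forall e : R, 0 < e -> exists2 A, F A & forall s, S s -> A s -> v s < e].
Proof.
have f_small (e : R) : 0 < e -> exists x, spike x < e.
  by move=> /v_small[s Ss vs]; exists s; rewrite spike_site.
pose Y := adjoin_point dX spike_gt0 ((induces_continuous _ dX).1 spike_continuous) f_small.
exists (trace Y); split=> [|A /trace_adjoin_point[e e0 eA]|e e0]; first by exists Y.
  by exists e => // s Ss vs; apply: eA; rewrite spike_site.
exists [set x | spike x < e]; first by apply/trace_adjoin_point; exists e.
by move=> s Ss /=; rewrite spike_site.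
Qed.

End SpikeFunction.

(** * Counting the traces *)

Section Counting.
Local Open Scope card_scope.
Variables (R : realType) (X : topologicalType).

(** A subset [W] of [B * nat] codes the filter generated by the sequence of open
sets whose [n]-th term is the union of the [b] with [(b, n)] in [W]. *)
Lemma traces_le_powerset (B : set (set X)) : basis B ->
  traces R (X := X) #<= [set: set (B * nat)].
Proof.
move=> [Bo Bx].
pose gen (W : set (B * nat)) : set (set X) :=
  [set A | exists n, forall b : B, W (b, n) -> sval b `<=` A].
apply: card_le_trans (card_image_le gen _).
apply: subset_card_le => F [Y ->].
have [d [dm dY]] := (metrizableP R Y).1 (ext_metrizable Y).
pose U n := [set x | d (ext_point Y) (ext_incl Y x) < n.+1%:R^-1].
have Uopen n : open (U n).
  apply/(ext_embedding Y).2; exists [set y | d (ext_point Y) y < n.+1%:R^-1] => //.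
  exact: (dball_open (conj dm dY)).
exists [set bn | sval bn.1 `<=` U bn.2] => //.
apply/seteqP; split=> A.
  move=> [n nA]; apply/(dY (ext_point Y)); exists n.+1%:R^-1.
    by rewrite invr_gt0 ltr0n.
  move=> y yn x xy; have Ux : U n x by rewrite /U /= xy.
  have [b [Bb bx] bU] := Bx x (U n) (open_nbhs_nbhs (conj (Uopen n) Ux)).
  exact: (nA (SigSub (mem_set Bb))).
move=> /(dY (ext_point Y))[e e0 eA]; have [n ne] := exists_invS_lt e0.
exists n => b bU x /bU Ux; apply: (eA (ext_incl Y x)) => //.
exact: lt_trans Ux ne.
Qed.

(** The points [j (a, n)] of [S] form sequences indexed by [a : option S]. For a
subset [E] of [S] the weight [v E] tends to 0 along the sequences with [a = None]
or [a = Some s], [s] in [E], and is 1 elsewhere. The sequence of index [None]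
keeps the infimum equal to 0 when [E] is empty. *)
Lemma powerset_le_traces (d : X -> X -> R) (r : X -> R) (S : set X) :
  induces d -> (forall x, 0 < r x) -> (forall x y, r x <= r y + d x y) ->
  (forall x y, S x -> S y -> x <> y -> r x <= 4 * d x y) ->
  infinite_set S -> [set: set S] #<= traces R (X := X).
Proof.
move=> dX r_gt0 r_lip S_sep Sinf.
have [|j0 j0inj] := @infinite_setX_nat S.
  by rewrite (eq_finite_set (card_setT S)).
have [x0 Sx0] := infinite_setN0 Sinf.
pose s0 : S := SigSub (mem_set Sx0).
pose o (a : option S) := if a is Some s then (s, 0%N) else (s0, 1%N).
have oinj : injective o by case=> [s|] [t|] //= [->].
pose j (an : option S * nat) := sval (j0 (j0 (o an.1), an.2)).
have jinj : injective j by move=> [a m] [b n] /val_inj/j0inj[/j0inj/oinj -> ->].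
have jS an : S (j an) by exact: (set_mem (svalP (j0 _))).
(* A partial inverse of [j], to define the weights by cases on the point. *)
have [k kj] : exists k : X -> option (option S * nat), forall an, k (j an) = Some an.
  have /choice[k kP] (x : X) : exists o : option (option S * nat),
      forall an, j an = x -> o = Some an.
    have [[an <-]|nj] := pselect (exists an, j an = x).
      by exists (Some an) => bn /jinj ->.
    by exists None => an xj; exfalso; apply: nj; exists an.
  by exists k => an; exact: kP.
pose chosen (E : set S) (a : option S) := if a is Some s then E s else True.
pose v (E : set S) (x : X) : R :=
  if k x is Some (a, n) then
    if `[< chosen E a >] then n.+1%:R^-1 else 1 else 1.
have vj E a n : v E (j (a, n)) = if `[< chosen E a >] then n.+1%:R^-1 else 1.
  by rewrite /v kj.
have v_gt0 E x : 0 < v E x.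
  by rewrite /v; case: (k x) => [[a n]|//]; case: ifP => // _; rewrite invr_gt0 ltr0n.
have v_le1 E x : v E x <= 1.
  rewrite /v; case: (k x) => [[a n]|//]; case: ifP => // _.
  by rewrite invf_le1 ?ltr0n // ler1n.
have v_small E (e : R) : 0 < e -> exists2 s, S s & v E s < e.
  move=> /exists_invS_lt[n ne]; exists (j (None, n)) => //.
  by rewrite vj asboolT.
have /choice[F FP] (E : set S) := trace_with_values dX r_gt0 r_lip S_sep
  (v_gt0 E) (v_le1 E) (v_small E).
have Fsub E E' : F E = F E' -> E `<=` E'.
  move=> EE' s Es; have [_ near_E _] := FP E; have [_ _ small_E'] := FP E'.
  (* In [A] all points of [S] have weight less than 1 for [E'], while [A]
     contains the far points of the sequence of [s], as [s] is in [E]. *)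
  have [A FA AS] := small_E' 1 ltr01.
  have [|e e0 eA] := near_E A; first by rewrite EE'.
  have [n ne] := exists_invS_lt e0.
  have := AS (j (Some s, n)) (jS _); rewrite vj; case: asboolP => //= _.
  have Asn : A (j (Some s, n)) by apply: eA => //; rewrite vj asboolT.
  by rewrite ltxx => /(_ Asn).
rewrite -(card_le_eqr (card_setT (traces R (X := X)))).
apply/card_leT_injP.
have TF E : traces R (F E) by have [] := FP E.
exists (fun E => SigSub (mem_set (TF E))) => E E' /(congr1 sval) /= EE'.
by apply/seteqP; split; exact: Fsub.
Qed.

End Counting.

Theorem theorem6p1 (R : realType) (X : topologicalType)
    (X_metrizable : metrizable R X)
    (X_locally_compact : locally_compact [set: X])
    (X_noncompact : ~ compact [set: X]) :
  equipotent (one_point_extensions R X) (set (weight_basis X)).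
Proof.
have [d dX] := (metrizableP R X).1 X_metrizable.
have [S S_sep S_cov] := maximal_separated dX X_locally_compact.
have Sinf := separated_infinite dX X_locally_compact X_noncompact S_cov.
have /card_eqPle[wS Sw] :=
  weight_basis_eq_separated dX X_locally_compact X_noncompact S_sep S_cov.
have upper : (traces R (X := X) #<= [set: set (weight_basis X)])%card.
  apply: card_le_trans (traces_le_powerset R (weight_basisP X).1) _.
  apply: card_le_powerset; apply/card_leT_injP; apply: infinite_setX_nat.
  rewrite (eq_finite_set (card_setT (weight_basis X))).
  by move=> /(card_le_finite Sw).
have lower : ([set: set (weight_basis X)] #<= traces R (X := X))%card.
  apply: (@card_le_trans _ _ _ [set: set S]).
    by apply/card_le_powerset/card_leT_injP/card_le_injP.
  exact: (powerset_le_traces dX (compact_radius_gt0 dX X_locally_compact)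
    (compact_radius_lipschitz dX) S_sep Sinf).
have [f f_bij] := extensions_equipotent_traces R X.
have /card_bijP[g g_bij] := Cantor_Bernstein upper lower.
exists (fun C => sval (g (f C))).
apply: bij_comp (bij_comp g_bij f_bij).
exists (fun E => SigSub (mem_set (I : [set: set (weight_basis X)] E))) => // E.
exact: val_inj.
Qed.
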